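(* Let $a,b$ be positive integers. There exists an Eisenstein lattice equable parallelogram with sides of length $a\sqrt3$ and $b\sqrt3$ if and only if $9a^2b^2-12(a+b)^2$ is a square (of an integer).
   Context: A planar polygon is equable if its perimeter equals its area. The Eisenstein lattice is $\mathbb{Z}[\omega]\subset\mathbb{C}$, where $\omega=-\frac12+i\frac{\sqrt3}{2}$. An Eisenstein lattice equable parallelogram (ELEP) is an equable parallelogram in the plane $\mathbb{C}$ all of whose vertices lie in $\mathbb{Z}[\omega]$. *)

(* Defs.v *)
From HB Require Import structures.
From mathcomp Require Import all_boot all_order all_algebra.
From mathcomp Require Import all_classical all_reals all_analysis.
From mathcomp Require Import complex.

Set Implicit Arguments.
Unset Strict Implicit.
Unset Printing Implicit Defensive.

Import Order.TTheory GRing.Theory Num.Theory.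

Local Open Scope classical_set_scope.
Local Open Scope ring_scope.
Local Open Scope complex_scope.

Definition omega (R : realType) : R[i] := (- (1 / 2)) +i* (Num.sqrt 3 / 2).

Definition eisenstein_lattice (R : realType) : set R[i] :=
  [set z | exists m n : int, z = m%:~R + n%:~R * omega R].

(* On R[i] the norm [`|z|] is itself an element of R[i] (with zero imaginary
   part), hence the projection. *)
Definition dist (R : realType) (z w : R[i]) : R := complex.Re `|w - z|.

(* The vertices are listed in cyclic order, so that AB, BC, CD, DA are the
   sides. The second clause (the directions AB and AD are linearly independent
   over R) excludes flat parallelograms. *)
Definition parallelogram (R : realType) (A B C D : R[i]) : Prop :=
  B - A = C - D /\
  forall s t : R, s%:C * (B - A) + t%:C * (D - A) = 0 -> s = 0 /\ t = 0.

Definition perimeter (R : realType) (A B C D : R[i]) : R :=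
  dist A B + dist B C + dist C D + dist D A.

(* The closed region bounded by the parallelogram ABCD. The vertex C does not
   occur, being determined by the three others. *)
Definition solid_parallelogram (R : realType) (A B D : R[i]) : set R[i] :=
  [set z | exists s t : R, [/\ 0 <= s <= 1, 0 <= t <= 1 &
    z = A + s%:C * (B - A) + t%:C * (D - A)]].

(* Planar Lebesgue measure, transported to R[i] along (x, y) |-> x + iy. *)
Definition area (R : realType) (S : set R[i]) : \bar R :=
  (@lebesgue_measure R \x @lebesgue_measure R)%E
    [set p : R * R | S (p.1 +i* p.2)].

Definition equable (R : realType) (A B C D : R[i]) : Prop :=
  (perimeter A B C D)%:E = area (solid_parallelogram A B D).

Definition ELEP (R : realType) (A B C D : R[i]) : Prop :=
  [/\ parallelogram A B C D, equable A B C D,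
      eisenstein_lattice A /\ eisenstein_lattice B &
      eisenstein_lattice C /\ eisenstein_lattice D].

(* Main.v *)
Require Import Defs.
From HB Require Import structures.
From mathcomp Require Import all_boot all_order all_algebra.
From mathcomp Require Import all_classical all_reals all_analysis.
From mathcomp Require Import measurable_realfun.
From mathcomp Require Import complex ring lra zify.

(* Let x, y in Z[omega] be the side vectors, with norms 3a^2 and 3b^2. The area
   is |x cross y|, so equability says |x cross y| = 2 sqrt 3 (a + b), and
   Lagrange's identity |x|^2 |y|^2 = (x . y)^2 + (x cross y)^2 shows that
   9a^2b^2 - 12(a+b)^2 is the square of x . y, which is a priori half an integer
   and hence an integer. Conversely, if it equals k^2 then 3 divides k and
   a + b, the Eisenstein integer k + 2(a+b) i sqrt 3 is 3w with w of norm
   (ab)^2, and since Z[omega] is Euclidean w factors as u v with N u = a^2 and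
   N v = b^2; the sides i sqrt 3 u and i sqrt 3 (conj v) then do the job. *)

Set Implicit Arguments.
Unset Strict Implicit.
Unset Printing Implicit Defensive.

Import Order.TTheory GRing.Theory Num.Theory.

Local Open Scope ring_scope.
Local Open Scope classical_set_scope.
Local Open Scope complex_scope.

(** * The area of a parallelogram *)

(** Pushing Lebesgue measure forward along [y - c] keeps the length of half-open intervals, and
    these lengths determine the measure. *)
Lemma lebesgue_measure_shift (R : realType) (c : R)
    (A : set (measurableTypeR R)) :
  measurable A ->
  lebesgue_measure ((fun y : R => y - c) @^-1` A) = lebesgue_measure A.
Proof.
move=> mA.
have mf : measurable_fun [set: measurableTypeR R]
    (fun y : measurableTypeR R => (y - c : measurableTypeR R)).
  by apply: measurable_funB.
apply/esym; pose f : measurableTypeR R -> measurableTypeR R := fun y => y - c.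
unshelve refine (lebesgue_measure_unique
  (mu := pushforward lebesgue_measure f) _ mA) => //.
move=> _ [[x y] _ <-] /=; rewrite /pushforward.
have -> : f @^-1` `]x, y] = `]x + c, y + c].
  apply/seteqP; split => z; rewrite /f /= !in_itv /= => /andP[? ?];
    apply/andP; split; lra.
rewrite !lebesgue_measure_itv /= !lte_fin ltrD2r.
by case: ifP => // _; rewrite -!EFinB; congr EFin; ring.
Qed.

Lemma lebesgue_measure_affine_unit (R : realType) (c w : R) : w != 0 ->
  lebesgue_measure [set z : R | 0 <= (z - c) / w <= 1] = `|w|%:E.
Proof.
rewrite neq_lt => /orP[w0|w0].
  have -> : [set z : R | 0 <= (z - c) / w <= 1] = `[c + w, c].
    apply/seteqP; split => z; rewrite /= in_itv /= ler_ndivlMr //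
      ler_ndivrMr // => /andP[? ?]; apply/andP; split; lra.
  rewrite lebesgue_measure_itv /= lte_fin ltr0_norm // gtrDl w0 -EFinB.
  by congr EFin; ring.
have -> : [set z : R | 0 <= (z - c) / w <= 1] = `[c, c + w].
  by apply/seteqP; split => z; rewrite /= in_itv /= ler_pdivlMr //
    ler_pdivrMr // => /andP[? ?]; apply/andP; split; lra.
rewrite lebesgue_measure_itv /= lte_fin gtr0_norm // ltrDl w0 -EFinB.
by congr EFin; ring.
Qed.

Lemma measurable_unit_preimage d (T : measurableType d) (R : realType)
    (f : T -> R) : measurable_fun [set: T] f ->
  measurable [set p | 0 <= f p <= 1].
Proof.
move=> mf; rewrite -[X in measurable X]setTI.
have -> : [set p | 0 <= f p <= 1] = f @^-1` `[0, 1].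
  by apply/seteqP; split=> p; rewrite /= in_itv.
by apply: mf => //; exact: measurable_itv.
Qed.

(** Horizontal sections are intervals of length [|w|] for heights in a set of measure [|h|], and
    empty otherwise. *)
Lemma product_lebesgue_sheared_rectangle (R : realType) (x0 w h c : R) :
  w != 0 -> h != 0 ->
  let Q := [set p : measurableTypeR R * measurableTypeR R |
    0 <= p.2 / h <= 1 /\ 0 <= (p.1 - (x0 + c * p.2)) / w <= 1] in
  measurable Q /\
  (@lebesgue_measure R \x @lebesgue_measure R)%E Q = `|w * h|%:E.
Proof.
move=> w0 h0 Q.
have mQ : measurable Q.
  have m1 : measurable_fun [set: measurableTypeR R * measurableTypeR R]
      (fun p : R * R => p.1) by exact: measurable_fst.
  have m2 : measurable_fun [set: measurableTypeR R * measurableTypeR R]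
      (fun p : R * R => p.2) by exact: measurable_snd.
  apply: measurableI; apply: measurable_unit_preimage.
    by apply: measurable_funM => //; exact: measurable_cst.
  apply: measurable_funM; last exact: measurable_cst.
  apply: measurable_funB => //.
  apply: measurable_funD; first exact: measurable_cst.
  by apply: measurable_funM => //; exact: measurable_cst.
split=> //.
(* Integrating in the other order makes the sections horizontal, where the shear is a mere
   translation. *)
transitivity ((@lebesgue_measure R \x^ @lebesgue_measure R)%E Q).
  by apply: product_measure_unique => //= *; rewrite product_measure2E.
pose S := [set q : R | 0 <= q / h <= 1].
have mS : measurable (S : set (measurableTypeR R)).
  apply: measurable_unit_preimage.
  by apply: measurable_funM => //; exact: measurable_cst.
rewrite /product_measure2.
transitivity (\int[@lebesgue_measure R]_q (`|w|%:E * (\1_S q)%:E)%E)%E.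
  apply: eq_integral => q _ /=; rewrite indicE.
  have [qS|qS] := boolP (q \in S).
    rewrite mule1 -(lebesgue_measure_affine_unit (x0 + c * q) w0) //.
    congr lebesgue_measure; apply/seteqP; split => z; rewrite /ysection /= !inE.
      by case.
    by move=> hz; split => //; move: qS; rewrite inE.
  rewrite mule0 -(measure0 (@lebesgue_measure R)); congr lebesgue_measure.
  apply/seteqP; split => z; rewrite /ysection /= ?inE // => -[hq _].
  by move: qS; rewrite notin_setE; apply.
rewrite ge0_integralZl ?integral_indic ?setIT //; last exact: measurableT_comp.
have E : lebesgue_measure S = `|h|%:E.
  rewrite -(lebesgue_measure_affine_unit 0 h0).
  by congr lebesgue_measure; apply/seteqP; split=> q; rewrite /S /= subr0.

by rewrite normrM EFinM -E.
Qed.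

Definition parallelogram_set (R : realType) (x0 y0 u1 u2 v1 v2 : R) :
    set (measurableTypeR R * measurableTypeR R) :=
  [set p | exists s t : R, [/\ 0 <= s <= 1, 0 <= t <= 1 &
     p = (x0 + s * u1 + t * v1, y0 + s * u2 + t * v2)]].

Lemma parallelogram_setC (R : realType) (x0 y0 u1 u2 v1 v2 : R) :
  parallelogram_set x0 y0 u1 u2 v1 v2 = parallelogram_set x0 y0 v1 v2 u1 u2.
Proof.
by apply/seteqP; split=> p [s [t [hs ht ->]]]; exists t, s; split => //;
  congr pair; ring.
Qed.

(* The shear (x, y) |-> (x, y - u2 / u1 * (x - x0) - y0) makes the first side
   horizontal; it translates every vertical section. *)
Lemma product_lebesgue_parallelogram_neq0 (R : realType)
    (x0 y0 u1 u2 v1 v2 : R) :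
  u1 != 0 -> u1 * v2 - u2 * v1 != 0 ->
  (@lebesgue_measure R \x @lebesgue_measure R)%E
    (parallelogram_set x0 y0 u1 u2 v1 v2) = `|u1 * v2 - u2 * v1|%:E.
Proof.
move=> u0 d0; set d := u1 * v2 - u2 * v1 in d0 *.
have h0 : d / u1 != 0 by rewrite mulf_neq0 ?invr_neq0.
(* The shear sends the second side to ([v1], [d / u1]), whence the height and the inverse slope
   [v1 / (d / u1)]. *)
have [mQ areaQ] :=
  product_lebesgue_sheared_rectangle x0 (v1 / (d / u1)) u0 h0.
rewrite (_ : `|d| = `|u1 * (d / u1)|); last by congr `|_|; field.
rewrite -areaQ /product_measure1; apply: eq_integral => x _ /=.
rewrite -(lebesgue_measure_shift (y0 + u2 / u1 * (x - x0))
  (measurable_xsection x mQ)).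
congr lebesgue_measure; apply/seteqP; split=> y; rewrite /xsection /= !inE.
  move=> [s [t [hs ht [-> ->]]]] /=.
  rewrite (_ : _ / (d / u1) = t); last by rewrite /d; field; apply/andP.
  split => //.
  by rewrite (_ : _ / u1 = s) //; rewrite /d; field; apply/andP.
move=> /= [ht hs]; do 2!eexists; split; [exact: hs|exact: ht|].
by congr pair; rewrite /d; field; apply/andP.
Qed.

(** If [u1 = 0], the determinant forces [v1 != 0], and the two sides can be exchanged. *)
Lemma product_lebesgue_parallelogram (R : realType) (x0 y0 u1 u2 v1 v2 : R) :
  u1 * v2 - u2 * v1 != 0 ->
  (@lebesgue_measure R \x @lebesgue_measure R)%E
    (parallelogram_set x0 y0 u1 u2 v1 v2) = `|u1 * v2 - u2 * v1|%:E.
Proof.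
move=> d0; have [u0|u0] := eqVneq u1 0; last first.
  exact: product_lebesgue_parallelogram_neq0.
have E : v1 * u2 - v2 * u1 = - (u1 * v2 - u2 * v1) by ring.
rewrite parallelogram_setC product_lebesgue_parallelogram_neq0.
- by rewrite E normrN.
- by apply: contraNneq d0 => ->; rewrite u0 mulr0 mul0r subrr.
- by rewrite E oppr_eq0.
Qed.

Definition cross (R : realType) (z w : R[i]) : R :=
  complex.Re z * complex.Im w - complex.Im z * complex.Re w.

Lemma area_solid_parallelogram (R : realType) (A B D : R[i]) :
  cross (B - A) (D - A) != 0 ->
  area (solid_parallelogram A B D) = `|cross (B - A) (D - A)|%:E.
Proof.
move=> d0; rewrite -(product_lebesgue_parallelogram
  (complex.Re A) (complex.Im A) d0).
congr product_measure1; apply/seteqP; split => -[x y] [s [t [hs ht e]]];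
  exists s, t; split => //; move: A B D d0 e => [A1 A2] [B1 B2] [D1 D2] _ /=.
- by simpc => -[-> ->].
- by case=> -> ->; simpc.
Qed.

(** * Factorization of Eisenstein integers *)

(* The pair [(a, b)] stands for [a + b * omega]. *)
Definition eis : Type := (int * int)%type.
HB.instance Definition _ := GRing.Zmodule.on eis.

(** Expands the product with [omega ^ 2 = - 1 - omega]. *)
Definition eis_mul (x y : eis) : eis :=
  (x.1 * y.1 - x.2 * y.2, x.1 * y.2 + x.2 * y.1 - x.2 * y.2).

Fact eis_mulA : associative eis_mul.
Proof. by move=> [a b] [c d] [e f]; congr pair => /=; ring. Qed.
Fact eis_mulC : commutative eis_mul.
Proof. by move=> [a b] [c d]; congr pair => /=; ring. Qed.
Fact eis_mul1 : left_id ((1, 0) : eis) eis_mul.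
Proof. by move=> [a b]; congr pair => /=; ring. Qed.
Fact eis_mulDl : left_distributive eis_mul +%R.
Proof. by move=> [a b] [c d] [e f]; congr pair => /=; ring. Qed.
Fact eis_oner_neq0 : ((1, 0) : eis) != 0. Proof. by []. Qed.

HB.instance Definition _ := GRing.Zmodule_isComNzRing.Build eis
  eis_mulA eis_mulC eis_mul1 eis_mulDl eis_oner_neq0.

Definition eis_norm (x : eis) : int := x.1 ^+ 2 - x.1 * x.2 + x.2 ^+ 2.

(** The complex conjugate of [omega] is [- 1 - omega]. *)
Definition eis_conj (x : eis) : eis := (x.1 - x.2, - x.2).

Definition eis_int (n : int) : eis := (n, 0).

Lemma eis_normM x y : eis_norm (x * y) = eis_norm x * eis_norm y.
Proof. by case: x y => [a b] [c d]; rewrite /eis_norm /=; ring. Qed.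

Lemma eis_norm_int n : eis_norm (eis_int n) = n ^+ 2.
Proof. by rewrite /eis_norm /=; ring. Qed.

Lemma eis_norm_conj x : eis_norm (eis_conj x) = eis_norm x.
Proof. by case: x => [a b]; rewrite /eis_norm /=; ring. Qed.

Lemma eis_mul_conj x : x * eis_conj x = eis_int (eis_norm x).
Proof. by case: x => [a b]; rewrite /eis_norm; congr pair => /=; ring. Qed.

Lemma eis_norm_ge0 x : 0 <= eis_norm x.
Proof. by case: x => [a b]; rewrite /eis_norm /=; nia. Qed.

Lemma eis_norm_eq0 x : (eis_norm x == 0) = (x == 0).
Proof.
apply/eqP/eqP => [|->] //; case: x => [a b]; rewrite /eis_norm /= => h.
have a0 : a = 0 by nia.
have b0 : b = 0 by nia.
by rewrite a0 b0.
Qed.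

(** Rounding both coordinates of [x * eis_conj y / eis_norm y] to nearest integers leaves errors of
    at most 1/2, hence an error of norm at most 3/4. *)
Lemma eis_euclid (x y : eis) : y != 0 ->
  exists q : eis, eis_norm (x - q * y) < eis_norm y.
Proof.
rewrite -eis_norm_eq0 => y0.
have n0 : 0 < eis_norm y by rewrite lt_neqAle eq_sym y0 eis_norm_ge0.
have round (z : int) : exists q r : int, z = q * eis_norm y + r /\
    `|2 * r| <= eis_norm y.
  set n := eis_norm y in n0 *.
  pose e := (z %% n)%Z; pose f := (z %/ n)%Z.
  have zE : z = f * n + e := divz_eq z n.
  have e0 : 0 <= e by apply: modz_ge0; lia.
  have en : e < n by apply: ltz_pmod; lia.
  have [le|le] := leP (2 * e) n; first by exists f, e; split; lia.
  by exists (f + 1), (e - n); split; lia.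
have [q1 [r1 [e1 h1]]] := round (x * eis_conj y).1.
have [q2 [r2 [e2 h2]]] := round (x * eis_conj y).2.
pose q : eis := (q1, q2); exists q; rewrite -(ltr_pM2r n0).
suff : (x - q * y) * eis_conj y = ((r1, r2) : eis).
  move=> /(congr1 eis_norm); rewrite eis_normM eis_norm_conj => ->.
  by rewrite {1}/eis_norm /=; nia.
rewrite mulrBl -mulrA eis_mul_conj.
have -> : x * eis_conj y = ((x * eis_conj y).1, (x * eis_conj y).2) :> eis.
  by case: (x * _).
by rewrite e1 e2; congr pair => /=; ring.
Qed.

(** The Euclidean algorithm, by induction on the norm of [y]. *)
Lemma eis_bezout (x y : eis) : y != 0 ->
  exists g s t x' y' : eis, [/\ g = s * x + t * y, x = g * x' & y = g * y'].
Proof.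
have [n] := ubnP `|eis_norm y|%N.
elim: n x y => // n IH x y lt_n y0.
have [q hq] := eis_euclid x y0.
have [r0|r0] := eqVneq (x - q * y) 0.
  exists y, 0, 1, q, 1; split; [ring | | ring].
  by move/eqP: r0; rewrite subr_eq0 => /eqP ->; ring.
have [|g [s [t [y' [r' [gE yE rE]]]]]] := IH y (x - q * y) _ r0.
  by have := eis_norm_ge0 (x - q * y); lia.
exists g, t, (s - t * q), (r' + q * y'), y'; split => //.
- by rewrite {1}gE; ring.
- by rewrite -{1}[x](subrK (q * y)) {1}rE {1}yE; ring.
Qed.

Lemma eis_norm_add_intM (p : int) (x y : eis) :
  (p %| eis_norm x -> p %| eis_norm (x + eis_int p * y))%Z.
Proof.
move=> /dvdzP[k kE]; apply/dvdzP.
case: x y kE => [a b] [c d]; rewrite /eis_norm /= => kE.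
exists (k + 2 * a * c - a * d - b * c + 2 * b * d
  + p * (c ^+ 2 - c * d + d ^+ 2)).
by rewrite !mulrDl -kE; ring.
Qed.

(** Take for [g] a gcd of [w] and [p]. Its norm divides [p ^ 2], and is a multiple of [p] because
    [g] is congruent to a multiple of [w] modulo [p]. *)
Lemma eis_common_divisor (p : nat) (w : eis) : prime p ->
  (p%:Z %| eis_norm w)%Z ->
  exists g w' p' : eis, [/\ w = g * w', eis_int p = g * p' &
    eis_norm g = p \/ eis_norm g = p%:Z ^+ 2].
Proof.
move=> pp pw; have p1 := prime_gt1 pp.
have p0 : eis_int p != 0 by rewrite -eis_norm_eq0 eis_norm_int; nia.
have [g [s [t [w' [p' [gE wE pE]]]]]] := eis_bezout w p0.
exists g, w', p'; split => //.
have pg : (p%:Z %| eis_norm g)%Z.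
  rewrite gE [t * _]mulrC; apply: eis_norm_add_intM.
  by rewrite eis_normM dvdz_mull.
have : (`|eis_norm g|%N %| p ^ 2)%N.
  have := congr1 absz (eis_norm_int p).
  by rewrite pE eis_normM abszM abszX /= => <-; rewrite dvdn_mulr.
case/(dvdn_pfactor _ _ pp) => m m2 gm.
have gN : eis_norm g = (p ^ m)%N by have := eis_norm_ge0 g; lia.
case: m m2 gm gN => [|[|[|]]] // _ _ gN.
- by move: pg; rewrite gN expn0 dvdz1 /=; lia.
- by left; rewrite gN expn1.
- by right; rewrite gN; lia.
Qed.

(** A common divisor with [p] either has norm [p ^ 2] already, or has norm [p] and a second one is
    extracted from the cofactor. *)
Lemma eis_factor_prime_square (p : nat) (n : int) (w : eis) : prime p ->
  eis_norm w = p%:Z ^+ 2 * n ->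
  exists u w' : eis, w = u * w' /\ eis_norm u = p%:Z ^+ 2.
Proof.
move=> pp wN; have p1 := prime_gt1 pp.
have pn0 : p%:Z != 0 by lia.
have [|g [w' [p' [wE pE]]]] := eis_common_divisor pp (w := w).
  by rewrite wN expr2 -mulrA dvdz_mulr.
case=> gN; last by exists g, w'.
have w'N : eis_norm w' = p%:Z * n.
  by apply: (mulfI pn0); rewrite -{1}gN -eis_normM -wE wN; ring.
have [|h [w'' [p'' [w'E p''E]]]] := eis_common_divisor pp (w := w').
  by rewrite w'N dvdz_mulr.
case=> hN.
  by exists (g * h), w''; rewrite -mulrA -w'E eis_normM gN hN expr2.
(* Here [h] divides [p] and has the same norm, so it is an associate of [p]; thus [p] itself divides
   [w] and serves as [u]. *)
have p''N : eis_norm p'' = 1.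
  apply: (mulfI (expf_neq0 2 pn0)).
  by rewrite -{1}hN -eis_normM -p''E eis_norm_int mulr1.
have hE : h = eis_int p * eis_conj p''.
  by rewrite p''E -mulrA eis_mul_conj p''N -[eis_int 1]/(1 : eis) mulr1.
exists (eis_int p), (g * eis_conj p'' * w''); split.
  by rewrite {1}wE {1}w'E {1}hE; ring.
exact: eis_norm_int.
Qed.

(** Induction on [a]: its least prime factor [p] splits off a factor of norm [p ^ 2], leaving
    [a / p]. *)
Lemma eis_factor_norm_squares (a b : nat) (w : eis) : (0 < a)%N ->
  eis_norm w = a%:Z ^+ 2 * b%:Z ^+ 2 ->
  exists u v : eis,
    [/\ w = u * v, eis_norm u = a%:Z ^+ 2 & eis_norm v = b%:Z ^+ 2].
Proof.
have [n] := ubnP a; elim: n a b w => // n IH a b w lt_n a0 wN.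
have [a1|a1] := leqP a 1.
  exists 1, w; rewrite mul1r wN (_ : a = 1%N); last by lia.
  by rewrite expr1n mul1r.
have pp := pdiv_prime a1; set p := pdiv a in pp.
have p1 := prime_gt1 pp.
have aE : a = (p * (a %/ p))%N by rewrite mulnC divnK ?pdiv_dvd.
set c := (a %/ p)%N in aE.
have c0 : (0 < c)%N by nia.
have wN' : eis_norm w = p%:Z ^+ 2 * (c%:Z ^+ 2 * b%:Z ^+ 2).
  by rewrite wN aE PoszM; ring.
have [u [w' [wE uN]]] := eis_factor_prime_square pp wN'.
have w'N : eis_norm w' = c%:Z ^+ 2 * b%:Z ^+ 2.
  have p20 : p%:Z ^+ 2 != 0 by rewrite expf_neq0 //; lia.
  by apply: (mulfI p20); rewrite -wN' wE eis_normM uN.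
have [|u' [v [w'E u'N vN]]] := IH c b w' _ c0 w'N; first by nia.
exists (u * u'), v; split => //; first by rewrite wE w'E mulrA.
by rewrite eis_normM uN u'N aE PoszM; ring.
Qed.

(** * Integer arithmetic of the square condition *)

Definition eis_cross (x y : eis) : int := x.1 * y.2 - x.2 * y.1.

(* The identity |z|^2 |w|^2 = (z . w)^2 + (z x w)^2, multiplied by 4. *)
Lemma eis_lagrange (x y : eis) :
  (2 * x.1 * y.1 - x.1 * y.2 - x.2 * y.1 + 2 * x.2 * y.2) ^+ 2
    + 3 * eis_cross x y ^+ 2 = 4 * (eis_norm x * eis_norm y).
Proof. by case: x y => [a b] [c d]; rewrite /eis_cross /eis_norm /=; ring. Qed.

(** An odd [K] would have a square congruent to 1 modulo 4. Applied with [K] twice the dot product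
    of the sides. *)
Lemma square_of_double_square (m K : int) : K ^+ 2 = 4 * m ->
  exists k : int, m = k ^+ 2.
Proof.
move=> KE; exists (K %/ 2)%Z.
have := divz_eq K 2; have := @modz_ge0 K 2 isT; have := @ltz_pmod K 2 isT.
set k := (K %/ 2)%Z; set r := (K %% 2)%Z => r2 r0 E.
have [r1|r1] : r = 0 \/ r = 1 by lia.
  by move: KE; rewrite E r1; nia.
suff: False by [].
have : K ^+ 2 = 4 * (k ^+ 2 + k) + 1 by rewrite E r1; ring.
by rewrite KE; lia.
Qed.

Lemma dvd3_of_equable_square (a b : nat) (k : int) :
  9 * a%:Z ^+ 2 * b%:Z ^+ 2 - 12 * (a%:Z + b%:Z) ^+ 2 = k ^+ 2 ->
  exists s k1 : int, a%:Z + b%:Z = 3 * s /\ k = 3 * k1.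
Proof.
have dvd3_sq (z : int) : (3 %| z ^+ 2)%Z -> exists t : int, z = 3 * t.
  move=> h; have /dvdzP[t ->] : (3 %| z)%Z.
    by move: h; rewrite !dvdzE abszX Euclid_dvdX // => /andP[].
  by exists t; rewrite mulrC.
move=> kE; have [k1 k1E] : exists k1, k = 3 * k1.
  apply: dvd3_sq; apply/dvdzP.
  exists (3 * a%:Z ^+ 2 * b%:Z ^+ 2 - 4 * (a%:Z + b%:Z) ^+ 2).
  by rewrite -kE; ring.
have [s sE] : exists s, a%:Z + b%:Z = 3 * s.
  apply: dvd3_sq; apply/dvdzP.
  (* From [4 (a + b)^2 = 3 a^2 b^2 - 3 k1^2], after subtracting [3 (a + b)^2]. *)
  exists (a%:Z ^+ 2 * b%:Z ^+ 2 - k1 ^+ 2 - (a%:Z + b%:Z) ^+ 2).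
  have : 3 * (3 * a%:Z ^+ 2 * b%:Z ^+ 2 - 4 * (a%:Z + b%:Z) ^+ 2) =
      3 * (3 * k1 ^+ 2).
    by move: kE; rewrite k1E => kE; lia.
  by move=> /(mulfI (_ : 3 != 0))-/(_ isT) ?; lia.
by exists s, k1.
Qed.

(* With theta = 1 + 2 omega = i sqrt 3, the sought sides satisfy
   x * conj y = k + 2 (a + b) theta = 3 w with N w = a^2 b^2. A factorization
   w = u v with N u = a^2, N v = b^2 gives x = theta u, y = theta (conj v). *)
Lemma eis_sides_exist (a b : nat) (k : int) : (0 < a)%N ->
  9 * a%:Z ^+ 2 * b%:Z ^+ 2 - 12 * (a%:Z + b%:Z) ^+ 2 = k ^+ 2 ->
  exists x y : eis, [/\ eis_norm x = 3 * a%:Z ^+ 2, eis_norm y = 3 * b%:Z ^+ 2 &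
    `|eis_cross x y| = 4 * (a%:Z + b%:Z)].
Proof.
move=> a0 kE; have [s [k1 [sE k1E]]] := dvd3_of_equable_square kE.
(* This is [k1 + 2 s theta], a third of [k + 2 (a + b) theta]. *)
pose w : eis := (k1 + 2 * s, 4 * s).
have wN : eis_norm w = a%:Z ^+ 2 * b%:Z ^+ 2.
  have -> : eis_norm w = k1 ^+ 2 + 12 * s ^+ 2 by rewrite /eis_norm /=; ring.
  apply: (mulfI (_ : 9 != 0)) => //.
  have -> : 9 * (a%:Z ^+ 2 * b%:Z ^+ 2) =
      9 * a%:Z ^+ 2 * b%:Z ^+ 2 - 12 * (a%:Z + b%:Z) ^+ 2
      + 12 * (a%:Z + b%:Z) ^+ 2 by ring.
  by rewrite kE sE k1E; ring.
have [u [v [wE uN vN]]] := eis_factor_norm_squares a0 wN.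
pose theta : eis := (1, 2).
exists (theta * u), (theta * eis_conj v); split.
- by rewrite eis_normM uN.
- by rewrite eis_normM eis_norm_conj vN.
(* [eis_cross x y] is minus the [omega] coordinate of [x * eis_conj y], here [3 * (u * v)] since
   [theta] has norm 3. *)
have -> : eis_cross (theta * u) (theta * eis_conj v) = - 3 * (u * v).2.
  by rewrite /eis_cross; case: u v {wE uN vN} => [? ?] [? ?] /=; ring.
by rewrite -wE sE /=; lia.
Qed.

(** * Eisenstein integers in the complex plane *)

Section Embedding.
Variable R : realType.

Definition eis_embed (x : eis) : R[i] := x.1%:~R + x.2%:~R * omega R.

Lemma eis_embedE (x : eis) : eis_embed x =
  (x.1%:~R - x.2%:~R / 2) +i* (x.2%:~R * (Num.sqrt 3 / 2)).
Proof.
rewrite /eis_embed /omega -!(rmorph_int (real_complex R)) /=; simpc.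
by congr Complex; field.
Qed.

Lemma sqr_sqrt3 : Num.sqrt 3 ^+ 2 = 3 :> R.
Proof. by rewrite sqr_sqrtr. Qed.

Lemma sqrt3_gt0 : 0 < Num.sqrt 3 :> R.
Proof. by rewrite sqrtr_gt0. Qed.

Lemma eis_embedB x y : eis_embed (x - y) = eis_embed x - eis_embed y.
Proof. by rewrite /eis_embed /= !rmorphB /=; ring. Qed.

Lemma eisenstein_lattice_embed x : eisenstein_lattice (eis_embed x).
Proof. by exists x.1, x.2. Qed.

Lemma eisenstein_latticeB (z w : R[i]) :
  eisenstein_lattice z -> eisenstein_lattice w ->
  exists x, z - w = eis_embed x.
Proof.
by move=> [m [n ->]] [m' [n' ->]]; exists ((m, n) - (m', n'));
  rewrite eis_embedB.
Qed.

Lemma dist_embed (A B : R[i]) x : B - A = eis_embed x ->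
  dist A B = Num.sqrt (eis_norm x)%:~R.
Proof.
move=> E; rewrite /dist E normc_def /= eis_embedE /=; congr Num.sqrt.
rewrite exprMn exprMn sqr_sqrt3 /eis_norm rmorphD rmorphB rmorphM !rmorphXn /=.
by field.
Qed.

Lemma dist_eq_sqrt3 (A B : R[i]) x (a : nat) : B - A = eis_embed x ->
  dist A B = a%:R * Num.sqrt 3 <-> eis_norm x = 3 * a%:Z ^+ 2.
Proof.
move=> /dist_embed ->; split => [/(congr1 (fun r => r ^+ 2))|->].
  rewrite sqr_sqrtr ?ler0z ?eis_norm_ge0 // exprMn sqr_sqrt3 => E.
  apply: (@intr_inj R); rewrite E rmorphM rmorphXn /= pmulrn.
  by ring.
rewrite rmorphM rmorphXn /= mulrC sqrtrM ?sqr_ge0 //.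
by rewrite sqrtr_sqr ger0_norm // ler0n.
Qed.

(** The factor is the area of the parallelogram spanned by 1 and [omega]. *)
Lemma cross_embed x y :
  cross (eis_embed x) (eis_embed y) = Num.sqrt 3 / 2 * (eis_cross x y)%:~R :> R.
Proof.
by rewrite /cross !eis_embedE /= /eis_cross rmorphB !rmorphM /=; field.
Qed.

(** A nonzero determinant gives independence by Cramer's rule. *)
Lemma parallelogramP (A B C D : R[i]) :
  parallelogram A B C D <-> B - A = C - D /\ cross (B - A) (D - A) != 0.
Proof.
rewrite /parallelogram; move: (C - D) (D - A) (B - A) => w [v1 v2] [u1 u2].
rewrite /cross /=; split=> -[E lin]; split=> //; last first.
  move=> s t; simpc => -[e1 e2]; split; apply: (mulIf lin); rewrite mul0r.
  - have -> : s * (u1 * v2 - u2 * v1) =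
      v2 * (s * u1 + t * v1) - v1 * (s * u2 + t * v2) by ring.
    by rewrite e1 e2; ring.
  - have -> : t * (u1 * v2 - u2 * v1) =
      u1 * (s * u2 + t * v2) - u2 * (s * u1 + t * v1) by ring.
    by rewrite e1 e2; ring.
apply/eqP => c0.
(* With zero determinant, [v_i u - u_i v = 0] for [i = 1, 2], so independence kills all coordinates,
   which is absurd. *)
have [_ /eqP] : v1 = 0 /\ - u1 = 0.
  by apply: lin; simpc; congr Complex; lra.
rewrite oppr_eq0 => /eqP u1E.
have [_ /eqP] : v2 = 0 /\ - u2 = 0.
  by apply: lin; simpc; congr Complex; lra.
rewrite oppr_eq0 => /eqP u2E.
have [/eqP] : 1 = 0 :> R /\ 0 = 0 :> R.
  by apply: lin; rewrite u1E u2E; simpc; congr Complex; ring.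
by rewrite oner_eq0.
Qed.

Lemma parallelogram_perimeter (A B C D : R[i]) : B - A = C - D ->
  perimeter A B C D = 2 * (dist A B + dist B C).
Proof.
move=> E; have E' : D - A = C - B by rewrite -[C](subrK D) -E; ring.
rewrite /perimeter /dist (distrC A D) (distrC D C) -E E'; ring.
Qed.

End Embedding.

(** * Equability in lattice coordinates and the equivalence *)

Lemma ELEP_cross_norm (R : realType) (A B C D : R[i]) (x y : eis) (a b : nat) :
  B - A = eis_embed R x -> D - A = eis_embed R y -> C - B = eis_embed R y ->
  dist A B = a%:R * Num.sqrt 3 -> dist B C = b%:R * Num.sqrt 3 ->
  parallelogram A B C D ->
  equable A B C D <-> `|eis_cross x y| = 4 * (a%:Z + b%:Z).
Proof.
move=> xE yE yE' ABE BCE par; rewrite /equable.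
have [_ c0] := (parallelogramP A B C D).1 par.
rewrite area_solid_parallelogram // xE yE cross_embed normrM.
rewrite (parallelogram_perimeter par.1) ABE BCE.
have s0 := sqrt3_gt0 R.
rewrite ger0_norm; last by lra.
rewrite -intr_norm.
have -> : 2 * (a%:R * Num.sqrt 3 + b%:R * Num.sqrt 3) =
    Num.sqrt 3 / 2 * (4 * (a%:Z + b%:Z))%:~R :> R.
  by rewrite rmorphM rmorphD /= -!pmulrn; field.
(* Perimeter and area now share the factor [sqrt 3 / 2], which cancels. *)
split => [[]|->] //.
by move=> /mulfI-/(_ (lt0r_neq0 (divr_gt0 s0 (ltr0Sn _ 1))))/intr_inj.
Qed.

Unset Implicit Arguments.

Theorem theorem1 (R : realType) (a b : nat) (ha : (0 < a)%N) (hb : (0 < b)%N) :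
  (exists A B C D : complex R,
     ELEP A B C D /\
     dist A B = a%:R * Num.sqrt 3 /\
     dist B C = b%:R * Num.sqrt 3) <->
  (exists k : int,
     9 * a%:Z ^+ 2 * b%:Z ^+ 2 - 12 * (a%:Z + b%:Z) ^+ 2 = k ^+ 2).
Proof.
split.
  move=> [A [B [C [D [[par eq [LA LB] [LC LD]] [ABE BCE]]]]]].
  have [x xE] := eisenstein_latticeB LB LA.
  have [y yE] := eisenstein_latticeB LD LA.
  have yE' : C - B = eis_embed R y.
    by rewrite -yE -[C](subrK D) -par.1; ring.
  have cE := (ELEP_cross_norm xE yE yE' ABE BCE par).1 eq.
  have xN := (dist_eq_sqrt3 a xE).1 ABE; have yN := (dist_eq_sqrt3 b yE').1 BCE.
  have c2 : eis_cross x y ^+ 2 = 16 * (a%:Z + b%:Z) ^+ 2.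
    by rewrite -real_normK ?num_real // cE; ring.
  have KE := canRL (addrK _) (eis_lagrange x y).
  (* [4 * 9 a^2 b^2 - 3 * 16 (a + b)^2] is 4 times the required number. *)
  by apply: (square_of_double_square (etrans KE _)); rewrite xN yN c2; ring.
move=> [k kE]; have [x [y [xN yN cE]]] := eis_sides_exist ha kE.
pose A : R[i] := eis_embed R 0; pose B := eis_embed R x.
pose D := eis_embed R y; pose C := eis_embed R (x + y).
have xE : B - A = eis_embed R x by rewrite -eis_embedB subr0.
have yE : D - A = eis_embed R y by rewrite -eis_embedB subr0.
have yE' : C - B = eis_embed R y by rewrite -eis_embedB addrC addKr.
have ABE := (dist_eq_sqrt3 a xE).2 xN; have BCE := (dist_eq_sqrt3 b yE').2 yN.
have par : parallelogram A B C D.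
  apply/parallelogramP; rewrite xE yE cross_embed; split.
    by rewrite -eis_embedB addrK.
  apply: mulf_neq0; first by rewrite gt_eqF // divr_gt0 ?sqrt3_gt0.
  (* The parallelogram is not flat because [4 (a + b) > 0]. *)
  by rewrite intr_eq0 -normr_eq0 cE; lia.
exists A, B, C, D; split => //; split => //.
- exact: (ELEP_cross_norm xE yE yE' ABE BCE par).2.
- by split; exact: eisenstein_lattice_embed.
- by split; exact: eisenstein_lattice_embed.
Qed.
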